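(* Let $G_1$ and $G_2$ be graphs with disjoint vertex sets. Then $\mathrm{indthin}(G_1\cup G_2)=\max\{\mathrm{indthin}(G_1),\mathrm{indthin}(G_2)\}$ and $\mathrm{indpthin}(G_1\cup G_2)=\max\{\mathrm{indpthin}(G_1),\mathrm{indpthin}(G_2)\}$.
   Context: Graphs are finite, simple, undirected. The union $G_1\cup G_2$ is $(V_1\cup V_2, E_1\cup E_2)$. For a graph $G=(V,E)$, an ordering $v_1,\dots,v_n$ of $V$ and a partition of $V$ are consistent if for every $r<s<t$, whenever $v_r,v_s$ are in the same class and $v_tv_r\in E$, then $v_tv_s\in E$; they are strongly consistent if moreover for every $r<s<t$, whenever $v_s,v_t$ are in the same class and $v_tv_r\in E$, then $v_sv_r\in E$. $\mathrm{indthin}(G)$ (independent thinness) is the minimum $k$ such that some ordering of $V$ and some partition of $V$ into $k$ independent sets are consistent; $\mathrm{indpthin}(G)$ (independent proper thinness) is defined likewise with strongly consistent. *)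

(* Defs.v *)
From mathcomp Require Import all_boot.

Set Implicit Arguments.
Unset Strict Implicit.
Unset Printing Implicit Defensive.

(* Finite simple graphs whose vertices are drawn from a common ambient finite
   type, so that the vertex sets of two graphs can be compared and united. *)
Record sgraph (T : finType) := SGraph {
  vset : {set T};
  adj : rel T;
  adj_sym : symmetric adj;
  adj_irrefl : irreflexive adj;
  adj_vset : forall x y, adj x y -> (x \in vset) && (y \in vset)
}.

Section Graphs.
Variable T : finType.
Implicit Types (G : sgraph T) (P : {set {set T}}).

Section Union.
Variables G1 G2 : sgraph T.

Definition union_adj : rel T := fun x y => adj G1 x y || adj G2 x y.

Lemma union_adj_sym : symmetric union_adj.
Proof. by move=> x y; rewrite /union_adj [adj G1 x y]adj_sym [adj G2 x y]adj_sym. Qed.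

Lemma union_adj_irrefl : irreflexive union_adj.
Proof. by move=> x; rewrite /union_adj !adj_irrefl. Qed.

Lemma union_adj_vset x y : union_adj x y ->
  (x \in vset G1 :|: vset G2) && (y \in vset G1 :|: vset G2).
Proof.
by rewrite !inE => /orP[] /adj_vset/andP[-> ->]; rewrite ?orbT.
Qed.

Definition graph_union : sgraph T :=
  SGraph union_adj_sym union_adj_irrefl union_adj_vset.

End Union.

Definition ordering G (v : #|vset G|.-tuple T) : bool :=
  uniq v && ([set x in v] == vset G).

Definition same_class P (x y : T) : bool :=
  [exists B in P, (x \in B) && (y \in B)].

Definition consistent G (v : #|vset G|.-tuple T) P : bool :=
  [forall r : 'I_#|vset G|, forall s : 'I_#|vset G|, forall t : 'I_#|vset G|,
    [&& r < s, s < t, same_class P (tnth v r) (tnth v s)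
      & adj G (tnth v t) (tnth v r)] ==> adj G (tnth v t) (tnth v s)].

Definition strongly_consistent G (v : #|vset G|.-tuple T) P : bool :=
  consistent v P &&
  [forall r : 'I_#|vset G|, forall s : 'I_#|vset G|, forall t : 'I_#|vset G|,
    [&& r < s, s < t, same_class P (tnth v s) (tnth v t)
      & adj G (tnth v t) (tnth v r)] ==> adj G (tnth v s) (tnth v r)].

Definition independent G (A : {set T}) : bool :=
  [forall x in A, forall y in A, ~~ adj G x y].

Definition independent_partition G P : bool :=
  partition P (vset G) && [forall B in P, independent G B].

Definition k_indthin G (k : nat) : bool :=
  [exists v : #|vset G|.-tuple T, exists P : {set {set T}},
    [&& ordering v, independent_partition G P, #|P| == k & consistent v P]].

Definition k_indpthin G (k : nat) : bool :=
  [exists v : #|vset G|.-tuple T, exists P : {set {set T}},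
    [&& ordering v, independent_partition G P, #|P| == k
      & strongly_consistent v P]].

(* The partition into singletons is strongly consistent with every ordering,
   so both minima below are over nonempty sets. *)
Lemma k_indpthin_card G : k_indpthin G #|vset G|.
Proof.
pose P := [set [set x] | x in vset G].
have ordP : ordering (enum_tuple (vset G)).
  rewrite /ordering enum_uniq; apply/eqP/setP => x.
  by rewrite inE /= mem_enum.
have same_eq x y : same_class P x y -> x = y.
  case/existsP=> B /and3P[/imsetP[z _ ->]].
  by rewrite !inE => /eqP-> /eqP->.
have tnthI (r s : 'I_#|vset G|) : r < s ->
    same_class P (tnth (enum_tuple (vset G)) r) (tnth (enum_tuple (vset G)) s) = false.
  move=> lt_rs; apply/negbTE/negP => E; have eq_rs := same_eq _ _ E.
  have /tuple_uniqP inj : uniq (enum_tuple (vset G)) by rewrite enum_uniq.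
  by move: lt_rs; rewrite (inj _ _ eq_rs) ltnn.
apply/existsP; exists (enum_tuple (vset G)); apply/existsP; exists P.
rewrite ordP /=; apply/and3P; split; last 1 first.
- apply/andP; split; do 3 apply/forallP => ?; apply/implyP;
    by case/and4P => lt1 lt2; rewrite tnthI.
- apply/andP; split.
  + apply/and3P; split.
    * rewrite /cover big_imset /=; last by move=> x y _ _ /set1_inj.
      apply/eqP/setP => x; apply/bigcupP/idP => [[y yV]|xV].
        by rewrite inE => /eqP->.
      by exists x; rewrite ?inE.
    * apply/trivIsetP => A B /imsetP[x _ ->] /imsetP[y _ ->] nAB.
      rewrite disjoints1 inE; apply: contraNneq nAB => ->; exact: eqxx.
    * by apply/negP => /imsetP[x _ /setP/(_ x)]; rewrite !inE eqxx.
  + apply/forall_inP => B /imsetP[x _ ->].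
    apply/forall_inP => y /set1P->; apply/forall_inP => z /set1P->.
    by rewrite adj_irrefl.
- by rewrite card_imset //; apply: set1_inj.
Qed.

Lemma k_indpthinW G k : k_indpthin G k -> k_indthin G k.
Proof.
case/existsP=> v /existsP[P /and4P[ov iP cP /andP[cvP _]]].
by apply/existsP; exists v; apply/existsP; exists P; apply/and4P.
Qed.

Lemma ex_k_indpthin G : exists k, k_indpthin G k.
Proof. by exists #|vset G|; apply: k_indpthin_card. Qed.

Lemma ex_k_indthin G : exists k, k_indthin G k.
Proof. by exists #|vset G|; apply/k_indpthinW/k_indpthin_card. Qed.

Definition indthin G : nat := ex_minn (ex_k_indthin G).

Definition indpthin G : nat := ex_minn (ex_k_indpthin G).

End Graphs.

(* Main.v *)
Require Import Defs.
From mathcomp Require Import all_boot.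

(** An ordering together with a partition into at most [m] classes amounts to a
    rank function [f], injective on the vertices, and a colouring [c] with
    values below [m].  In this form both bounds become transparent: a layout of
    the union is also a layout of each [G_i], and conversely two layouts are
    merged by reusing the same colours and ranking all of [G1] before all of
    [G2].  The vertices ranked between two adjacent vertices then lie in the
    same [G_i] as these, so no new condition arises. *)

Section Layouts.
Variable T : finType.
Implicit Types (G : sgraph T) (P : {set {set T}}) (f c : T -> nat).

(* [strong] selects between consistent and strongly consistent layouts. *)
Record layout (strong : bool) G (m : nat) f c : Prop := Layout {
  layout_inj : {in vset G &, injective f};
  layout_lt : {in vset G, forall x, c x < m};
  layout_proper : forall x y, adj G x y -> c x != c y;
  layout_fwd : forall x y z, y \in vset G -> f x < f y -> f y < f z ->
    c x = c y -> adj G z x -> adj G z y;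
  layout_bwd : strong -> forall x y z, y \in vset G -> f x < f y -> f y < f z ->
    c y = c z -> adj G z x -> adj G y x
}.

Lemma same_classE P D x y : partition P D -> x \in D -> y \in D ->
  same_class P x y = (pblock P x == pblock P y).
Proof.
case/and3P=> /eqP covP tiP _ xD yD.
apply/idP/eqP => [/existsP[B /and3P[BP xB yB]] | eq_xy].
  by rewrite (def_pblock tiP BP xB) (def_pblock tiP BP yB).
apply/existsP; exists (pblock P x).
by rewrite pblock_mem ?covP //= mem_pblock covP xD eq_xy mem_pblock covP.
Qed.

Lemma same_class_preim (rT : eqType) (c : T -> rT) (D : {set T}) x y :
  x \in D -> y \in D ->
  same_class (preim_partition c D) x y = (c x == c y).
Proof.
move=> xD yD; have pP := preim_partitionP c D.
rewrite (same_classE _ _ _ _ pP xD yD).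
have /and3P[/eqP covP tiP _] := pP.
rewrite eq_pblock ?covP // pblock_equivalence_partition //.
by move=> u v w _ _ _; split=> //= /eqP->.
Qed.

Lemma card_preim_partition c (D : {set T}) m :
  {in D, forall x, c x < m} -> #|preim_partition c D| <= m.
Proof.
move=> c_lt; rewrite -[leqRHS]card_ord.
pose F (i : 'I_m) := [set y in D | val i == c y].
apply: leq_trans (leq_imset_card F 'I_m); apply/subset_leq_card/subsetP => B.
by case/imsetP=> x xD ->; apply/imsetP; exists (Ordinal (c_lt x xD)).
Qed.

Lemma layout_of_ordering (strong : bool) G (v : #|vset G|.-tuple T) P :
  ordering v -> independent_partition G P -> consistent v P ->
  (strong -> strongly_consistent v P) ->
  layout strong G #|P| (index^~ v) (fun x => index (pblock P x) (enum P)).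
Proof.
case/andP=> v_uniq /eqP v_set /andP[pP /forall_inP indP] fwd bwd.
have /and3P[/eqP covP tiP _] := pP.
have memv x : (x \in v) = (x \in vset G) by rewrite -[in RHS]v_set inE.
have pbP x : x \in vset G -> pblock P x \in enum P.
  by move=> xV; rewrite mem_enum pblock_mem // covP.
have colE x y : x \in vset G -> y \in vset G ->
    index (pblock P x) (enum P) = index (pblock P y) (enum P) ->
    same_class P x y.
  move=> xV yV /(index_inj set0 (pbP x xV) (pbP y yV)) eq_xy.
  by rewrite (same_classE _ _ _ _ pP) // eq_xy.
(* Ranks are positions in [v], so layout conditions on vertices become conditions on indices in
   ['I_#|vset G|]. *)
have tnthP x : x \in vset G -> exists2 i : 'I_#|vset G|, tnth v i = x & index x v = i.
  rewrite -memv => /tnthP[i ->]; exists i => //.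
  by rewrite (tnth_nth (tnth v i)) index_uniq ?size_tuple.
have adjV x y : adj G x y -> x \in vset G /\ y \in vset G.
  by move/adj_vset/andP.
split.
- by move=> x y xV yV; apply: index_inj; rewrite ?memv.
- by move=> x xV; rewrite cardE index_mem pbP.
- move=> x y axy; have [xV yV] := adjV _ _ axy; apply/eqP => /(colE _ _ xV yV).
  case/existsP=> B /and3P[BP xB yB].
  by have /forall_inP/(_ x xB)/forall_inP/(_ y yB) := indP B BP; rewrite axy.
(* The edge already makes [x] and [z] vertices; for [y] this is the assumption [yV]. *)
- move=> x y z yV lt_xy lt_yz /colE cxy azx; have [zV xV] := adjV _ _ azx.
  have [[r rx ix] [i iy si] [t tz it]] := And3 (tnthP x xV) (tnthP y yV) (tnthP z zV).
  move/forallP/(_ r)/forallP/(_ i)/forallP/(_ t)/implyP: fwd.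
  rewrite rx iy tz -ix -si -it; apply.
  by rewrite lt_xy lt_yz cxy.
- move=> /bwd/andP[_ {}bwd] x y z yV lt_xy lt_yz /colE cyz azx.
  have [zV xV] := adjV _ _ azx.
  have [[r rx ix] [i iy si] [t tz it]] := And3 (tnthP x xV) (tnthP y yV) (tnthP z zV).
  move/forallP/(_ r)/forallP/(_ i)/forallP/(_ t)/implyP: bwd.
  rewrite rx iy tz -ix -si -it; apply.
  by rewrite lt_xy lt_yz cyz.
Qed.

(** Sort the vertices by rank and take the fibres of the colouring as classes; these are independent
    because the colouring is proper. *)
Lemma ordering_of_layout strong G m f c : layout strong G m f c ->
  exists (v : #|vset G|.-tuple T) P,
    [/\ ordering v, independent_partition G P, #|P| <= m, consistent v P
      & strong -> strongly_consistent v P].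
Proof.
case=> f_inj c_lt c_proper fwd bwd.
pose s := sort (relpre f leq) (enum (vset G)).
have size_s : size s == #|vset G| by rewrite size_sort cardE.
pose v : #|vset G|.-tuple T := Tuple size_s.
have v_uniq : uniq v by rewrite sort_uniq enum_uniq.
have memv x : (x \in v) = (x \in vset G) by rewrite mem_sort mem_enum.
have tnthV i : tnth v i \in vset G by rewrite -memv mem_tnth.
have f_lt (i j : 'I_#|vset G|) : i < j -> f (tnth v i) < f (tnth v j).
  (* Sorting only gives a weak inequality; injectivity of [f] on the vertices makes it strict. *)
  move=> lt_ij; rewrite ltn_neqAle; apply/andP; split.
    apply/eqP => /(f_inj _ _ (tnthV i) (tnthV j)).
    by move/(elimT (tuple_uniqP v) v_uniq) => eq_ij; rewrite eq_ij ltnn in lt_ij.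
  have s_sorted : sorted (relpre f leq) v.
    by apply: sort_sorted => x y; apply: leq_total.
  have f_tr : transitive (relpre f leq) by move=> x y z; apply: leq_trans.
  pose x0 := tnth v i; rewrite !(tnth_nth x0).
  by apply: (sorted_ltn_nth f_tr _ s_sorted); rewrite ?inE ?size_tuple.
have fwdv : consistent v (preim_partition c (vset G)).
  apply/forallP=> r; apply/forallP=> i; apply/forallP=> t.
  apply/implyP=> /and4P[/f_lt lt_ri /f_lt lt_it].
  by rewrite same_class_preim // => /eqP; apply: fwd.
exists v, (preim_partition c (vset G)); split=> //.
- by rewrite /ordering v_uniq; apply/eqP/setP=> x; rewrite inE memv.
- rewrite /independent_partition preim_partitionP; apply/forall_inP=> B.
  case/imsetP=> x xV ->; apply/forall_inP=> y; rewrite inE => /andP[_ /eqP xy].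
  apply/forall_inP=> z; rewrite inE => /andP[_ /eqP xz].
  by apply/negP=> /c_proper; rewrite -xy xz eqxx.
- exact: card_preim_partition.
move=> st; rewrite /strongly_consistent fwdv.
apply/forallP=> r; apply/forallP=> i; apply/forallP=> t.
apply/implyP=> /and4P[/f_lt lt_ri /f_lt lt_it].
by rewrite same_class_preim // => /eqP; apply: bwd.
Qed.

Lemma layout_widen strong G m n f c :
  m <= n -> layout strong G m f c -> layout strong G n f c.
Proof.
by move=> le_mn [? c_lt ? ? ?]; split=> // x /c_lt/leq_trans; apply.
Qed.

Lemma indthin_leP G m :
  indthin G <= m <-> exists f c, layout false G m f c.
Proof.
rewrite /indthin; case: ex_minnP => k kG k_min; split=> [le_km | [f [c]]].
  case/existsP: kG => v /existsP[P /and4P[ov iP /eqP<- cP]] in le_km k_min *.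
  do 2 eexists; apply: layout_widen le_km _.
  exact: layout_of_ordering ov iP cP _.
case/ordering_of_layout=> v [P [ov iP le_Pm cP _]].
apply: leq_trans le_Pm; apply: k_min.
by apply/existsP; exists v; apply/existsP; exists P; apply/and4P.
Qed.

Lemma indpthin_leP G m :
  indpthin G <= m <-> exists f c, layout true G m f c.
Proof.
rewrite /indpthin; case: ex_minnP => k kG k_min; split=> [le_km | [f [c]]].
  case/existsP: kG => v /existsP[P /and4P[ov iP /eqP<- cP]] in le_km k_min *.
  have /andP[fwd _] := cP; do 2 eexists; apply: layout_widen le_km _.
  exact: layout_of_ordering ov iP fwd _.
case/ordering_of_layout=> v [P [ov iP le_Pm _ /(_ isT) cP]].
apply: leq_trans le_Pm; apply: k_min.
by apply/existsP; exists v; apply/existsP; exists P; apply/and4P.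
Qed.

(** By disjointness no edge of [G2] touches [vset G1], so one endpoint there decides which graph an
    edge comes from. *)
Lemma graph_union_adjl G1 G2 x y : [disjoint vset G1 & vset G2] ->
  (x \in vset G1) || (y \in vset G1) ->
  adj (graph_union G1 G2) x y = adj G1 x y.
Proof.
move=> disjV xyV; rewrite /= /union_adj; case a2: (adj G2 x y); rewrite ?orbF //.
have /andP[x2 y2] := adj_vset a2; move: xyV.
by rewrite (disjointFl disjV x2) (disjointFl disjV y2).
Qed.

Lemma graph_union_adjr G1 G2 x y : [disjoint vset G1 & vset G2] ->
  (x \in vset G2) || (y \in vset G2) ->
  adj (graph_union G1 G2) x y = adj G2 x y.
Proof.
move=> disjV xyV; rewrite /= /union_adj orbC.
by apply: graph_union_adjl xyV; rewrite disjoint_sym.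
Qed.

(** The second hypothesis says that [H] is a union of components of [G]: no edge of [G] leaves
    [vset H]. The same ranks and colours then serve for [H]. *)
Lemma layout_sub strong G H m f c : vset H \subset vset G ->
  (forall x y, y \in vset H -> adj G x y = adj H x y) ->
  layout strong G m f c -> layout strong H m f c.
Proof.
move=> /subsetP sHG adjE [f_inj c_lt c_proper fwd bwd].
have adjEl x y : x \in vset H -> adj G x y = adj H x y.
  by move=> xH; rewrite adj_sym adjE // adj_sym.
have adjHV x y : adj H x y -> x \in vset H /\ y \in vset H by move/adj_vset/andP.
split.
- by move=> x y /sHG xG /sHG yG; apply: f_inj.
- by move=> x /sHG/c_lt.
- by move=> x y axy; have [_ yH] := adjHV _ _ axy; apply: c_proper; rewrite adjE.
- move=> x y z yH lt_xy lt_yz cxy azx; have [_ xH] := adjHV _ _ azx.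
  by rewrite -adjE //; apply: fwd lt_xy lt_yz cxy _; rewrite ?sHG ?adjE.
- move=> /bwd{}bwd x y z yH lt_xy lt_yz cyz azx; have [_ xH] := adjHV _ _ azx.
  by rewrite -adjEl //; apply: bwd lt_xy lt_yz cyz _; rewrite ?sHG ?adjE.
Qed.

Lemma layout_union strong G1 G2 m f1 c1 f2 c2 :
  [disjoint vset G1 & vset G2] ->
  layout strong G1 m f1 c1 -> layout strong G2 m f2 c2 ->
  exists f c, layout strong (graph_union G1 G2) m f c.
Proof.
move=> disjV [inj1 lt1 pr1 fwd1 bwd1] [inj2 lt2 pr2 fwd2 bwd2].
(* Strictly above every value of [f1], so that shifting [f2] by [N] ranks [G2] after [G1]. *)
pose N := (\max_x f1 x).+1.
have f1N x : f1 x < N by rewrite ltnS (leq_bigmax x).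
pose f x := if x \in vset G1 then f1 x else N + f2 x.
pose c x := if x \in vset G1 then c1 x else c2 x.
have not1 x : x \in vset G2 -> x \in vset G1 = false by apply: disjointFl.
have fE1 x : x \in vset G1 -> f x = f1 x by rewrite /f => ->.
have fE2 x : x \in vset G2 -> f x = N + f2 x by rewrite /f => /not1->.
have cE1 x : x \in vset G1 -> c x = c1 x by rewrite /c => ->.
have cE2 x : x \in vset G2 -> c x = c2 x by rewrite /c => /not1->.
have adjV1 x y : adj G1 x y -> x \in vset G1 /\ y \in vset G1 by move/adj_vset/andP.
have adjV2 x y : adj G2 x y -> x \in vset G2 /\ y \in vset G2 by move/adj_vset/andP.
(* Everything outside [vset G1] has rank at least [N], whether or not it is a vertex of the
   union. *)
have below y z : z \in vset G1 -> f y < f z -> y \in vset G1.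
  move=> z1; rewrite (fE1 z) // {1}/f; case: ifP => // _ lt_yz.
  by have := ltn_trans lt_yz (f1N z); rewrite ltnNge leq_addr.
(* Here [y] has to be a vertex of the union: elements of [T] outside both graphs also get ranks from
   [N] on. *)
have above x y : x \in vset G2 -> f x < f y ->
    y \in vset (graph_union G1 G2) -> y \in vset G2.
  move=> x2 lt_xy /setUP[y1|//]; move: (below _ _ y1 lt_xy).
  by rewrite not1.
exists f, c; split.
- move=> x y /setUP[x1|x2] /setUP[y1|y2].
  + by rewrite !fE1 //; apply: inj1.
  + by rewrite fE1 // fE2 // => e; have := f1N x; rewrite e ltnNge leq_addr.
  + by rewrite fE2 // fE1 // => e; have := f1N y; rewrite -e ltnNge leq_addr.
  + by rewrite !fE2 // => /addnI; apply: inj2.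
- by move=> x /setUP[xV|xV]; [rewrite cE1 ?lt1 | rewrite cE2 ?lt2].
- move=> x y /orP[a|a]; [have [xV yV] := adjV1 _ _ a | have [xV yV] := adjV2 _ _ a].
    by rewrite !cE1 // pr1.
  by rewrite !cE2 // pr2.
(* If the edge is in [G1], its later end [z] forces [y] into [G1]; if it is in [G2], its earlier end
   [x] forces [y] into [G2]. *)
- move=> x y z yV lt_xy lt_yz cxy /orP[a|a].
    have [zV xV] := adjV1 _ _ a; have y1 := below _ _ zV lt_yz.
    rewrite graph_union_adjl ?zV //; move: lt_xy lt_yz cxy.
    by rewrite !fE1 // !cE1 // => lt_xy lt_yz cxy; apply: fwd1 a.
  have [zV xV] := adjV2 _ _ a; have y2 := above _ _ xV lt_xy yV.
  rewrite graph_union_adjr ?zV //; move: lt_xy lt_yz cxy.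
  by rewrite !fE2 // !ltn_add2l !cE2 // => lt_xy lt_yz cxy; apply: fwd2 a.
- move=> st x y z yV lt_xy lt_yz cyz /orP[a|a].
    have [zV xV] := adjV1 _ _ a; have y1 := below _ _ zV lt_yz.
    rewrite graph_union_adjl ?y1 //; move: lt_xy lt_yz cyz.
    by rewrite !fE1 // !cE1 // => lt_xy lt_yz cyz; apply: bwd1 a.
  have [zV xV] := adjV2 _ _ a; have y2 := above _ _ xV lt_xy yV.
  rewrite graph_union_adjr ?y2 //; move: lt_xy lt_yz cyz.
  by rewrite !fE2 // !ltn_add2l !cE2 // => lt_xy lt_yz cyz; apply: bwd2 a.
Qed.

Lemma layout_unionP strong G1 G2 m : [disjoint vset G1 & vset G2] ->
  (exists f c, layout strong (graph_union G1 G2) m f c) <->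
  (exists f c, layout strong G1 m f c) /\ (exists f c, layout strong G2 m f c).
Proof.
move=> disjV; split=> [[f [c L]] | [[f1 [c1 L1]] [f2 [c2 L2]]]]; last first.
  exact: layout_union disjV L1 L2.
split; exists f, c; apply: layout_sub L; rewrite ?subsetUl ?subsetUr // => x y yV.
  by rewrite graph_union_adjl // yV orbT.
by rewrite graph_union_adjr // yV orbT.
Qed.

End Layouts.

(** A number is determined by its upper bounds: [m := maxn a b] gives one inequality and [m := n]
    the other. *)
Lemma eq_maxn_of_leq a b n :
  (forall m, n <= m <-> a <= m /\ b <= m) -> n = maxn a b.
Proof.
move=> le_n; apply/eqP; rewrite eqn_leq geq_max; apply/andP; split.
  by apply/le_n; rewrite leq_maxl leq_maxr.
by apply/andP/le_n.
Qed.

Theorem theorem4p9 (T : finType) (G1 G2 : sgraph T)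
    (disjV : [disjoint vset G1 & vset G2]) :
  indthin (graph_union G1 G2) = maxn (indthin G1) (indthin G2) /\
  indpthin (graph_union G1 G2) = maxn (indpthin G1) (indpthin G2).
Proof.
(* An upper bound [m] on either invariant is a layout with [m] colours, and such layouts pass
   between the union and the pair by [layout_unionP]. *)
split; apply: eq_maxn_of_leq => m.
  by split=> [/indthin_leP/layout_unionP-/(_ disjV)[] | []];
    do ?move/indthin_leP=> ?; [split | apply/indthin_leP/layout_unionP].
by split=> [/indpthin_leP/layout_unionP-/(_ disjV)[] | []];
  do ?move/indpthin_leP=> ?; [split | apply/indpthin_leP/layout_unionP].
Qed.
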